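(* Let $d_1\le d_2$ be positive integers, let $\rho$ be a density matrix on $\mathbb{C}^{d_1}\otimes\mathbb{C}^{d_2}$ with full Bloch coefficient matrix $C$, and let $k\ge1$ be an integer such that the Schmidt number of $\rho$ satisfies $\mathrm{SN}(\rho)\le k$. Let $x,y\ge0$ be real numbers, and let $D_x=\operatorname{diag}(x,1,\ldots,1)$ (of size $d_1^2\times d_1^2$) and $D_y=\operatorname{diag}(y,1,\ldots,1)$ (of size $d_2^2\times d_2^2$). Then $$\|D_xCD_y\|_{\mathrm{Tr}}\le\sqrt{(d_1-1+x^2)(d_2-1+y^2)}+\sqrt{d_1d_2}\,(k-1).$$
   Context: Local operator bases: $\{\lambda_i\}_{i=0}^{d_1^2-1}$ is a basis of the complex $d_1\times d_1$ matrices with $\lambda_0=\mathbb{1}$ and $\mathrm{Tr}(\lambda_i\lambda_j^\dagger)=d_1\delta_{ij}$; $\{\tilde\lambda_j\}_{j=0}^{d_2^2-1}$ is a basis of the complex $d_2\times d_2$ matrices with $\tilde\lambda_0=\mathbb{1}$ and $\mathrm{Tr}(\tilde\lambda_i\tilde\lambda_j^\dagger)=d_2\delta_{ij}$. The bases are otherwise arbitrary. Bloch decomposition: every density matrix $\rho$ on $\mathbb{C}^{d_1}\otimes\mathbb{C}^{d_2}$ is uniquely written as $$\rho=\frac1{d_1d_2}\Big[\mathbb{1}\otimes\mathbb{1}+\sum_{i=1}^{d_1^2-1}\alpha_i\lambda_i\otimes\mathbb{1}+\sum_{j=1}^{d_2^2-1}\beta_j\,\mathbb{1}\otimes\tilde\lambda_j+\sum_{i=1}^{d_1^2-1}\sum_{j=1}^{d_2^2-1}T_{ij}\,\lambda_i\otimes\tilde\lambda_j\Big].$$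 The full Bloch coefficient matrix $C$ is the $d_1^2\times d_2^2$ matrix (indices starting at $0$) with $C_{00}=1$, $C_{i0}=\alpha_i$, $C_{0j}=\beta_j$, $C_{ij}=T_{ij}$ for $i,j\ge1$; i.e. $\rho=\frac1{d_1d_2}\sum_{i,j}C_{ij}\lambda_i\otimes\tilde\lambda_j$. $\|\cdot\|_{\mathrm{Tr}}$ denotes the trace norm, i.e. the sum of the singular values. Schmidt number: the Schmidt rank $\mathrm{SR}(|\psi\rangle)$ of a unit vector $|\psi\rangle\in\mathbb{C}^{d_1}\otimes\mathbb{C}^{d_2}$ is the number of nonzero coefficients in its Schmidt decomposition. For a density matrix, $\mathrm{SN}(\rho)$ is the smallest $r$ such that $\rho=\sum_i p_i|\psi_i\rangle\langle\psi_i|$ for some finite probability distribution $(p_i)$ and unit vectors $|\psi_i\rangle$ with $\mathrm{SR}(|\psi_i\rangle)\le r$ for all $i$. *)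

(* Defs.v *)
From mathcomp Require Import all_boot all_order all_algebra.
From mathcomp Require Import spectral.
From mathcomp Require Import mxtens.

Set Implicit Arguments.
Unset Strict Implicit.
Unset Printing Implicit Defensive.

Import Order.TTheory GRing.Theory Num.Theory.
Local Open Scope ring_scope.
Local Open Scope sesquilinear_scope.

Section Defs.
Variable C : numClosedFieldType.

(* In a [numClosedFieldType], [0 <= z] forces [z] to be real. *)
Definition positive_semidefinite n (A : 'M[C]_n) : Prop :=
  A \is hermsymmx /\ forall v : 'cV[C]_n, 0 <= (v^t* *m A *m v) 0 0.

Definition density_matrix n (A : 'M[C]_n) : Prop :=
  positive_semidefinite A /\ \tr A = 1.

(* The singular values of [A] are the square roots of the eigenvalues of
   [A^t* *m A].  For m x n matrices this lists n of them, i.e. n - min(m, n)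
   extra zeros, which do not change their sum. *)
Definition singular_values m n (A : 'M[C]_(m, n)) : 'rV[C]_n :=
  \row_j sqrtC (spectral_diag (A^t* *m A) 0 j).

Definition trace_norm m n (A : 'M[C]_(m, n)) : C :=
  \sum_(j < n) singular_values A 0 j.

Definition inner n (u v : 'cV[C]_n) : C := (u^t* *m v) 0 0.

Definition unit_vector n (u : 'cV[C]_n) : Prop := inner u u = 1.

Definition orthonormal_family n (I : eqType) (u : I -> 'cV[C]_n) : Prop :=
  forall i j, inner (u i) (u j) = (i == j)%:R.

(* The Kronecker product of two columns has 1 * 1 columns, which is
   convertible to 1. *)
Definition tensv m n (u : 'cV[C]_m) (v : 'cV[C]_n) : 'cV[C]_(m * n) := u *t v.

Definition schmidt_decomposition d1 d2 (psi : 'cV[C]_(d1 * d2))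
    (s : 'I_(minn d1 d2) -> C) (u : 'I_(minn d1 d2) -> 'cV[C]_d1)
    (v : 'I_(minn d1 d2) -> 'cV[C]_d2) : Prop :=
  [/\ forall i, 0 <= s i, orthonormal_family u, orthonormal_family v
    & psi = \sum_i s i *: tensv (u i) (v i)].

(* [schmidt_rank psi r]: the Schmidt rank of [psi] is [r].  The coefficients
   are the singular values of [psi] reshaped as a d1 x d2 matrix, so every
   [psi] has such an [r] and it does not depend on the decomposition. *)
Definition schmidt_rank d1 d2 (psi : 'cV[C]_(d1 * d2)) (r : nat) : Prop :=
  exists s u v, schmidt_decomposition psi s u v /\ #|[set i | s i != 0]| = r.

Definition mixture_of_rank_le d1 d2 (rho : 'M[C]_(d1 * d2)) (r : nat) : Prop :=
  exists (n : nat) (p : 'I_n -> C) (psi : 'I_n -> 'cV[C]_(d1 * d2)),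
    [/\ forall i, 0 <= p i, \sum_i p i = 1,
        forall i, unit_vector (psi i),
        forall i, exists2 q, schmidt_rank (psi i) q & (q <= r)%N
      & rho = \sum_i p i *: (psi i *m (psi i)^t*)].

(* [schmidt_number rho r]: the Schmidt number of [rho] is [r]. *)
Definition schmidt_number d1 d2 (rho : 'M[C]_(d1 * d2)) (r : nat) : Prop :=
  mixture_of_rank_le rho r /\
  forall q, mixture_of_rank_le rho q -> (r <= q)%N.

Definition local_operator_basis d (lam : 'I_(d ^ 2) -> 'M[C]_d) : Prop :=
  [/\ basis_of {: 'M[C]_d} (codom lam),
      forall i, nat_of_ord i = 0%N -> lam i = 1%:M
    & forall i j, \tr (lam i *m (lam j)^t*) = d%:R * (i == j)%:R].

Definition bloch_coefficient_matrix d1 d2 (lam : 'I_(d1 ^ 2) -> 'M[C]_d1)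
    (mu : 'I_(d2 ^ 2) -> 'M[C]_d2) (rho : 'M[C]_(d1 * d2))
    (B : 'M[C]_(d1 ^ 2, d2 ^ 2)) : Prop :=
  (forall i j, nat_of_ord i = 0%N -> nat_of_ord j = 0%N -> B i j = 1) /\
  rho = (d1 * d2)%:R^-1 *: \sum_i \sum_j B i j *: (lam i *t mu j).

(* diag(x, 1, ..., 1) *)
Definition diag_head n (x : C) : 'M[C]_n :=
  diag_mx (\row_(j < n) if nat_of_ord j == 0%N then x else 1).

End Defs.

Arguments diag_head {C} n x.

(* Main.v *)
(* The trace norm of A is |Tr (W A)| for some contraction W, and |Tr (W A)| is
   convex in the state, so a single pure state psi of Schmidt rank at most k
   suffices.  With psi = sum_a s_a u_a (x) v_a, the matrix D_x C D_y is the sum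
   over pairs (a, b) of the rank-one matrices s_a s_b (D_x f_ab) (D_y g_ab)^T,
   where f_ab and g_ab are the local coefficient vectors of u_a u_b^* and
   v_a v_b^*.  By Parseval |f_ab|^2 = d1, and the head entry of f_ab is
   Tr (u_a u_b^* ) = [a = b], so |D_x f_ab|^2 is d1 - 1 + x^2 if a = b and d1
   otherwise.  The triangle inequality concludes, since sum_a s_a^2 = 1 and
   sum_(a != b) s_a s_b = (sum_a s_a)^2 - 1 <= k - 1. *)
Require Import Defs.
From mathcomp Require Import all_boot all_order all_algebra.
From mathcomp Require Import spectral mxtens complex.
From mathcomp Require Import reals.
Import Order.TTheory GRing.Theory Num.Theory.
Local Open Scope ring_scope.
Local Open Scope complex_scope.

Section TraceNorm.
Set Implicit Arguments.
Unset Strict Implicit.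
Local Open Scope sesquilinear_scope.
Variable C : numClosedFieldType.

(** * Inner products and Cauchy-Schwarz *)

Lemma trmxC_mul m n p (A : 'M[C]_(m, n)) (B : 'M[C]_(n, p)) :
  (A *m B)^t* = B^t* *m A^t*.
Proof. by rewrite trmx_mul map_mxM. Qed.

Lemma innerE n (u v : 'cV[C]_n) : inner u v = \sum_i (u i 0)^* * v i 0.
Proof. by rewrite /inner mxE; apply: eq_bigr => i _; rewrite !mxE. Qed.

Lemma inner_normE n (u : 'cV[C]_n) : inner u u = \sum_i `|u i 0| ^+ 2.
Proof. by rewrite innerE; apply: eq_bigr => i _; rewrite normCK mulrC. Qed.

Lemma inner_ge0 n (u : 'cV[C]_n) : 0 <= inner u u.
Proof. by rewrite inner_normE sumr_ge0 // => i _; rewrite exprn_ge0. Qed.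

Lemma inner_cauchy_schwarz n (u v : 'cV[C]_n) :
  `|inner u v| <= sqrtC (inner u u) * sqrtC (inner v v).
Proof.
have dotE (a b : 'cV[C]_n) : dotmx a^T b^T = (inner b a).
  rewrite dotmxE innerE mxE; apply: eq_bigr => i _.
  by rewrite !mxE mulrC.
rewrite mulrC -!dotE; exact: (CauchySchwarz_sqrt (@dotmx C n)).
Qed.

(** * Duality between the trace norm and contractions *)

(** Operator norm at most 1, in the bilinear form that fits rank-one matrices [f *m g^T]; a plain
    transpose of [g] is harmless, since conjugation preserves its norm. *)
Definition contraction m n (W : 'M[C]_(n, m)) : Prop :=
  forall (f : 'cV[C]_m) (g : 'cV[C]_n),
    `|(g^T *m W *m f) 0 0| <= sqrtC (inner f f) * sqrtC (inner g g).

(* [W] is the adjoint of the partial isometry in the polar decomposition of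
   [A]: with [A^t* A = P^t* diag(e) P] it is [P^t* diag(e^(-1/2)) P A^t*],
   where [0^-1 = 0] makes the inverse a pseudo-inverse. *)
Lemma trace_norm_dual m n (A : 'M[C]_(m, n)) :
  exists2 W : 'M[C]_(n, m), contraction W & trace_norm A = `|\tr (W *m A)|.
Proof.
pose M := A^t* *m A.
have MC : M^t* = M by rewrite trmxC_mul trmxCK.
have Mnormal : M \is normalmx by apply/normalmxP; rewrite MC.
pose P := spectralmx M; pose e := spectral_diag M.
have Pu : P \is unitarymx := spectral_unitarymx M.
have PPt : P *m P^t* = 1%:M by apply/unitarymxP.
have PtP : P^t* *m P = 1%:M by rewrite -invmx_unitary // mulVmx ?unitarymx_unit.
have ME : M = P^t* *m diag_mx e *m P.
  by rewrite -invmx_unitary //; exact/orthomx_spectralP.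
(* [diag_mx e] is a Gram matrix, so its diagonal entries are sums of squared moduli. *)
have e_ge0 j : 0 <= e 0 j.
  have De : diag_mx e = (A *m P^t*)^t* *m (A *m P^t*).
    rewrite trmxC_mul trmxCK -mulmxA [A^t* *m _]mulmxA -/M ME.
    by rewrite -!mulmxA PPt mulmx1 mulmxA PPt mul1mx.
  have /matrixP/(_ j j) := De.
  rewrite !mxE eqxx mulr1n => ->; rewrite sumr_ge0 // => i _.
  by rewrite mxE mxE mulrC mul_conjC_ge0.
pose h := \row_j (sqrtC (e 0 j))^-1.
have hC : (diag_mx h)^t* = diag_mx h.
  apply/matrixP => i j; rewrite !mxE eq_sym; case: eqP => [->|_].
    by rewrite !mulr1n geC0_conj // invr_ge0 sqrtC_ge0.
  by rewrite !mulr0n rmorph0.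
pose W := P^t* *m diag_mx h *m P *m A^t*.
(* This is the orthogonal projection onto the range of [M]: the pseudo-inverse kills the null
   coordinates, and elsewhere e^(-1/2) e e^(-1/2) = 1. *)
have WWC : W *m W^t* = P^t* *m diag_mx (\row_j (e 0 j != 0)%:R) *m P.
  rewrite !trmxC_mul !trmxCK hC -!mulmxA; congr (_ *m _).
  rewrite [A^t* *m _]mulmxA -/M ME -!mulmxA [P *m (_ *m _)]mulmxA PPt mul1mx.
  rewrite [P *m (_ *m _)]mulmxA PPt mul1mx !mulmxA !mulmx_diag; congr (diag_mx _ *m _).
  apply/rowP=> j; rewrite !mxE; have [->|nz] := eqVneq (e 0 j) 0.
    by rewrite mulr0 mul0r.
  rewrite -{2}[e 0 j]sqrtCK expr2 mulrA mulVf ?sqrtC_eq0 // mul1r.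
  by rewrite mulfV ?sqrtC_eq0.
exists W.
  (* [g^T] is the adjoint of [c], so it remains to see that the projection does not lengthen [c]. *)
  move=> f g; pose c := map_mx Num.conj g.
  have -> : (g^T *m W *m f) 0 0 = inner (W^t* *m c) f.
    by rewrite /inner trmxC_mul trmxCK -map_trmx -map_mx_comp map_mx_id // => z /=; rewrite conjCK.
  apply: le_trans (inner_cauchy_schwarz _ _) _; rewrite mulrC.
  apply: ler_wpM2l; first by rewrite sqrtC_ge0 inner_ge0.
  rewrite ler_sqrtC ?qualifE /= ?inner_ge0 //.
  have -> : inner g g = inner (P *m c) (P *m c).
    rewrite {2}/inner trmxC_mul -mulmxA [P^t* *m _]mulmxA PtP mul1mx.
    rewrite -/(inner c c) !inner_normE.
    by apply: eq_bigr => i _; rewrite mxE norm_conjC.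
  have -> : inner (W^t* *m c) (W^t* *m c) =
     \sum_j (e 0 j != 0)%:R * `|(P *m c) j 0| ^+ 2.
    rewrite {1}/inner trmxC_mul trmxCK -mulmxA [W *m _]mulmxA WWC.
    rewrite -!mulmxA mulmxA -trmxC_mul mxE; apply: eq_bigr => j _.
    by rewrite mul_diag_mx; move: (P *m c) => z; rewrite !mxE mulrCA normCK [z j 0 * _]mulrC.
  rewrite inner_normE ler_sum // => j _.
  by rewrite ler_piMl ?exprn_ge0 //; case: (_ != _).
(* By cyclicity the trace is that of diag(e^(-1/2) e), the sum of the square roots of [e]. *)
rewrite /W -!mulmxA -/M ME -!mulmxA [P *m (_ *m _)]mulmxA PPt mul1mx.
rewrite mxtrace_mulC -!mulmxA PPt mulmx1 mulmx_diag mxtrace_diag ger0_norm; last first.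
  by rewrite sumr_ge0 // => j _; rewrite !mxE mulr_ge0 ?invr_ge0 ?sqrtC_ge0.
apply: eq_bigr => j _; rewrite !mxE -/M -/e.
have [->|nz] := eqVneq (e 0 j) 0; first by rewrite sqrtC0 mulr0.
by rewrite -{3}[e 0 j]sqrtCK expr2 mulrA mulVf ?sqrtC_eq0 // mul1r.
Qed.

Lemma trace_contraction_rank1 m n (W : 'M[C]_(n, m)) (f : 'cV[C]_m) (g : 'cV[C]_n) :
  contraction W ->
  `|\tr (W *m (f *m g^T))| <= sqrtC (inner f f) * sqrtC (inner g g).
Proof.
move=> /(_ f g); congr (`|_| <= _).
by rewrite mulmxA mxtrace_mulC mulmxA /mxtrace big_ord1.
Qed.

(** * Bloch coefficients as traces *)

(** For a local operator basis these are [d] times the coordinates of [X], matching the prefactor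
    1/(d1 d2) of the Bloch decomposition. *)
Definition bloch_vec d (lam : 'I_(d ^ 2) -> 'M[C]_d) (X : 'M[C]_d) : 'cV[C]_(d ^ 2) :=
  \col_i \tr (X *m (lam i)^t*).

(** Defined on all operators, not only states, so that linearity reaches the cross terms of a pure
    state. *)
Definition bloch_mx d1 d2 (lam : 'I_(d1 ^ 2) -> 'M[C]_d1) (mu : 'I_(d2 ^ 2) -> 'M[C]_d2)
    (X : 'M[C]_(d1 * d2)) : 'M[C]_(d1 ^ 2, d2 ^ 2) :=
  \matrix_(i, j) \tr (X *m (lam i *t mu j)^t*).

Lemma mxtrace_tens m n (X : 'M[C]_m) (Y : 'M[C]_n) : \tr (X *t Y) = \tr X * \tr Y.
Proof.
by rewrite /mxtrace mulr_sum; apply: eq_bigr => i _; rewrite mxE.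
Qed.

Lemma trmxC_tens m n p q (X : 'M[C]_(m, n)) (Y : 'M[C]_(p, q)) :
  (X *t Y)^t* = X^t* *t Y^t*.
Proof. by rewrite trmx_tens map_mxT. Qed.

Section BlochMx.
Variables (d1 d2 : nat) (lam : 'I_(d1 ^ 2) -> 'M[C]_d1) (mu : 'I_(d2 ^ 2) -> 'M[C]_d2).

Lemma bloch_mx_tens (X : 'M[C]_d1) (Y : 'M[C]_d2) :
  bloch_mx lam mu (X *t Y) = bloch_vec lam X *m (bloch_vec mu Y)^T.
Proof.
apply/matrixP=> i j; rewrite !mxE big_ord1 !mxE.
by rewrite trmxC_tens tensmx_mul mxtrace_tens.
Qed.

Lemma bloch_mx_sum (I : finType) (c : I -> C) (X : I -> 'M[C]_(d1 * d2)) :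
  bloch_mx lam mu (\sum_i c i *: X i) = \sum_i c i *: bloch_mx lam mu (X i).
Proof.
apply/matrixP=> i j; rewrite summxE !mxE mulmx_suml raddf_sum /=.
by apply: eq_bigr => k _; rewrite -scalemxAl mxtraceZ !mxE.
Qed.

(** The product basis is orthogonal with squared norm d1 d2, which cancels the prefactor. *)
Lemma bloch_coefficient_matrixE (rho : 'M[C]_(d1 * d2)) B :
  (0 < d1)%N -> (0 < d2)%N ->
  local_operator_basis lam -> local_operator_basis mu ->
  bloch_coefficient_matrix lam mu rho B -> B = bloch_mx lam mu rho.
Proof.
move=> d1_gt0 d2_gt0 [_ _ lamO] [_ _ muO] [_ ->].
apply/matrixP=> i j; rewrite mxE -scalemxAl mxtraceZ pair_bigA /= mulmx_suml.
rewrite raddf_sum /= (bigD1 (i, j)) //= big1 ?addr0 => [|[a b] /= ne_ab].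
  rewrite -scalemxAl mxtraceZ trmxC_tens tensmx_mul mxtrace_tens lamO muO !eqxx.
  by rewrite !mulr1 -natrM mulrCA mulVf ?mulr1 // pnatr_eq0 -lt0n muln_gt0 d1_gt0.
rewrite -scalemxAl mxtraceZ trmxC_tens tensmx_mul mxtrace_tens lamO muO.
rewrite mulrACA -!natrM mulnb; case: andP => [[/eqP Da /eqP Db]|_]; last by rewrite muln0 !mulr0.
by rewrite Da Db eqxx in ne_ab.
Qed.

End BlochMx.

(** With X = sum_i c_i lam_i, both sides equal d^2 sum_i |c_i|^2. *)
Lemma bloch_vec_parseval d (lam : 'I_(d ^ 2) -> 'M[C]_d) (X : 'M[C]_d) :
  local_operator_basis lam ->
  inner (bloch_vec lam X) (bloch_vec lam X) = d%:R * \tr (X *m X^t*).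
Proof.
move=> [lam_basis _ lamO].
have [c ->] : exists c : 'I_(d ^ 2) -> C, X = \sum_i c i *: lam i.
  have /(coord_basis (X := in_tuple (codom lam)) lam_basis) := memvf X.
  move=> DX.
  have sz : size (codom lam) = (d ^ 2)%N by rewrite size_codom card_ord.
  exists (fun i => coord (in_tuple (codom lam)) (cast_ord (esym sz) i) X).
  rewrite {1}DX (reindex (cast_ord (esym sz))) /=; last first.
    by exists (cast_ord sz) => i _; rewrite ?cast_ordK ?cast_ordKV.
  apply: eq_bigr => i _; congr (_ *: _).
  by rewrite codomE (nth_map i) ?nth_ord_enum ?size_enum_ord.
pose X' := \sum_i c i *: lam i.
have cE i : \tr (X' *m (lam i)^t*) = d%:R * c i.
  rewrite mulmx_suml raddf_sum /= (bigD1 i) //= big1 ?addr0 => [|j /negPf ne_ji].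
    by rewrite -scalemxAl mxtraceZ lamO eqxx mulr1 mulrC.
  by rewrite -scalemxAl mxtraceZ lamO ne_ji !mulr0.
rewrite inner_normE -/X'.
rewrite {3}/X' linear_sum /= map_mx_sum mulmx_sumr raddf_sum mulr_sumr /=.
apply: eq_bigr => i _; rewrite mxE cE linearZ /= map_mxZ -scalemxAr mxtraceZ cE.
rewrite normrM normr_nat exprMn normCK expr2 -mulrA; congr (_ * _).
by rewrite [c i * _]mulrC mulrCA.
Qed.

(** Only the head entry is rescaled, and it is Tr X because lam_0 = 1; the rest is Parseval. *)
Lemma inner_diag_head_bloch_vec d (lam : 'I_(d ^ 2) -> 'M[C]_d) (X : 'M[C]_d) x :
  (0 < d)%N -> local_operator_basis lam -> 0 <= x ->
  let f := diag_head (d ^ 2) x *m bloch_vec lam X in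
  inner f f = d%:R * \tr (X *m X^t*) + (x ^+ 2 - 1) * `|\tr X| ^+ 2.
Proof.
move=> d_gt0 lamB x_ge0 f; rewrite -(bloch_vec_parseval X lamB) !inner_normE.
have d2_gt0 : (0 < d ^ 2)%N by rewrite expn_gt0 d_gt0.
pose o := Ordinal d2_gt0; have [_ lam0 _] := lamB.
rewrite (bigD1 o) //= [in RHS](bigD1 o) //= addrAC; congr (_ + _).
  rewrite /f mul_diag_mx !mxE /= lam0 // trmx1 map_mx1 mulmx1 normrM exprMn.
  by rewrite (ger0_norm x_ge0) mulrBl mul1r addrC subrK.
apply: eq_bigr => i ne_i0; rewrite /f mul_diag_mx !mxE.
by case: eqP => [i0|_]; [case/eqP: ne_i0; apply: val_inj | rewrite mul1r].
Qed.

(** * Schmidt coefficients and the pure-state bound *)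

(** Cauchy-Schwarz of [s] against the indicator of its support. *)
Lemma card_support_cauchy_schwarz n (s : 'I_n -> C) : (forall i, 0 <= s i) ->
  (\sum_i s i) ^+ 2 <= #|[set i | s i != 0]|%:R * \sum_i s i ^+ 2.
Proof.
move=> s_ge0.
pose u : 'cV[C]_n := \col_i (s i != 0)%:R; pose v : 'cV[C]_n := \col_i s i.
have := inner_cauchy_schwarz u v.
have -> : inner u v = \sum_i s i.
  rewrite innerE; apply: eq_bigr => i _; rewrite !mxE conjC_nat.
  by have [->|_] := eqVneq (s i) 0; rewrite ?mulr0 ?mul1r.
have -> : inner u u = #|[set i | s i != 0]|%:R.
  rewrite inner_normE -sum1dep_card natr_sum [RHS]big_mkcond /=.
  by apply: eq_bigr => i _; rewrite mxE; case: (s i != 0); rewrite ?normr1 ?normr0 ?expr1n ?expr0n.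
have -> : inner v v = \sum_i s i ^+ 2.
  by rewrite inner_normE; apply: eq_bigr => i _; rewrite mxE ger0_norm.
move=> /(lerXn2r 2); rewrite !nnegrE normr_ge0 mulr_ge0 ?sqrtC_ge0 ?sumr_ge0 ?ler0n //; last first.
  by move=> i _; rewrite exprn_ge0.
by move=> /(_ isT isT); rewrite exprMn !sqrtCK ger0_norm ?sumr_ge0.
Qed.

Lemma tensv_outer m n (u u' : 'cV[C]_m) (v v' : 'cV[C]_n) :
  tensv u v *m (tensv u' v')^t* = (u *m u'^t*) *t (v *m v'^t*).
Proof. by have := tensmx_mul u v (u'^t*) (v'^t*); rewrite -trmxC_tens. Qed.

Lemma mxtrace_outer n (u v : 'cV[C]_n) : \tr (u *m v^t*) = inner v u.
Proof. by rewrite mxtrace_mulC /mxtrace big_ord1. Qed.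

Lemma mxtrace_outer_sqr n (u v : 'cV[C]_n) :
  \tr ((u *m v^t*) *m (u *m v^t*)^t*) = inner u u * inner v v.
Proof.
rewrite trmxC_mul trmxCK -mulmxA [v^t* *m _]mulmxA [v^t* *m v]mx11_scalar.
by rewrite mul_scalar_mx -scalemxAr mxtraceZ mxtrace_outer mulrC.
Qed.

Lemma inner_diag_head_bloch_vec_outer d (lam : 'I_(d ^ 2) -> 'M[C]_d) x
    (I : eqType) (u : I -> 'cV[C]_d) (a b : I) :
  (0 < d)%N -> local_operator_basis lam -> 0 <= x -> orthonormal_family u ->
  let f := diag_head (d ^ 2) x *m bloch_vec lam (u a *m (u b)^t*) in
  inner f f = if a == b then d%:R - 1 + x ^+ 2 else d%:R.
Proof.
move=> d_gt0 lamB x_ge0 uO /=; rewrite inner_diag_head_bloch_vec //.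
rewrite mxtrace_outer mxtrace_outer_sqr !uO !eqxx !mulr1 eq_sym.
case: (a == b); last by rewrite normr0 expr0n mulr0 addr0.
by rewrite normr1 expr1n mulr1 addrA addrAC.
Qed.

(** Stated for an arbitrary contraction [W] instead of the trace norm, because one [W] must serve
    all pure states of a mixture. *)
Lemma schmidt_rank_bloch_le d1 d2
    (lam : 'I_(d1 ^ 2) -> 'M[C]_d1) (mu : 'I_(d2 ^ 2) -> 'M[C]_d2)
    (psi : 'cV[C]_(d1 * d2)) (q k : nat) (x y : C) (W : 'M[C]_(d2 ^ 2, d1 ^ 2)) :
  (0 < d1)%N -> (0 < d2)%N ->
  local_operator_basis lam -> local_operator_basis mu ->
  unit_vector psi -> schmidt_rank psi q -> (q <= k)%N ->
  0 <= x -> 0 <= y -> contraction W ->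
  `|\tr (W *m (diag_head _ x *m bloch_mx lam mu (psi *m psi^t*) *m diag_head _ y))|
    <= sqrtC ((d1%:R - 1 + x ^+ 2) * (d2%:R - 1 + y ^+ 2))
       + sqrtC (d1%:R * d2%:R) * (k%:R - 1).
Proof.
move=> d1_gt0 d2_gt0 lamB muB psi1 [s [u [v [[s_ge0 uO vO Dpsi] card_s]]]] le_qk.
move=> x_ge0 y_ge0 Wc.
have Dpp : psi *m psi^t* = \sum_(p : _ * _)
    (s p.1 * s p.2) *: ((u p.1 *m (u p.2)^t*) *t (v p.1 *m (v p.2)^t*)).
  rewrite {1}Dpsi mulmx_suml.
  rewrite -(pair_bigA _ (fun a b => (s a * s b) *:
    ((u a *m (u b)^t*) *t (v a *m (v b)^t*)))) /=.
  apply: eq_bigr => a _; rewrite Dpsi linear_sum /= map_mx_sum mulmx_sumr.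
  apply: eq_bigr => b _; rewrite linearZ /= map_mxZ -scalemxAl -scalemxAr.
  by rewrite tensv_outer scalerA /= geC0_conj.
(* Trace of [Dpp]: orthonormality removes the cross terms. *)
have s2 : \sum_i s i ^+ 2 = 1.
  rewrite -psi1 -mxtrace_outer Dpp raddf_sum /=.
  rewrite -(pair_bigA _ (fun a b => \tr ((s a * s b) *:
    ((u a *m (u b)^t*) *t (v a *m (v b)^t*))))) /=.
  apply: eq_bigr => a _; rewrite (bigD1 a) //= big1 ?addr0 => [|b /negPf ne_ba].
    by rewrite mxtraceZ mxtrace_tens !mxtrace_outer uO vO eqxx !mulr1 expr2.
  by rewrite mxtraceZ mxtrace_tens !mxtrace_outer uO vO ne_ba !mulr0.
set al := sqrtC (_ * (_ - 1 + _)); set be := sqrtC (d1%:R * _).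
have hd (d : nat) z : (0 < d)%N -> 0 <= z -> 0 <= d%:R - 1 + z ^+ 2 :> C.
  by move=> d_gt0 z_ge0; rewrite addr_ge0 ?exprn_ge0 // subr_ge0 ler1n.
have termE p : `|\tr (W *m (diag_head _ x *m ((s p.1 * s p.2) *:
     bloch_mx lam mu ((u p.1 *m (u p.2)^t*) *t (v p.1 *m (v p.2)^t*))) *m diag_head _ y))|
   <= s p.1 * s p.2 * (if p.1 == p.2 then al else be).
  rewrite -scalemxAr -scalemxAl -scalemxAr mxtraceZ normrM ger0_norm ?mulr_ge0 //.
  rewrite ler_wpM2l ?mulr_ge0 // bloch_mx_tens.
  set f := bloch_vec lam _; set g := bloch_vec mu _.
  have -> : diag_head _ x *m (f *m g^T) *m diag_head _ y
      = (diag_head _ x *m f) *m (diag_head _ y *m g)^T.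
    by rewrite trmx_mul tr_diag_mx !mulmxA.
  apply: le_trans (trace_contraction_rank1 _ _ Wc) _.
  rewrite !inner_diag_head_bloch_vec_outer //.
  by case: ifP => _; rewrite -rootCMl ?hd ?ler0n.
rewrite Dpp bloch_mx_sum mulmx_sumr mulmx_suml mulmx_sumr raddf_sum /=.
apply: le_trans (ler_norm_sum _ _ _) _.
apply: le_trans (ler_sum _ (fun p _ => termE p)) _.
(* Weight every pair by [be], then correct the diagonal by [al - be], whose total weight is 1 by
   [s2]. *)
have -> : \sum_p s p.1 * s p.2 * (if p.1 == p.2 then al else be)
    = al - be + be * (\sum_i s i) ^+ 2.
  rewrite -(pair_bigA _ (fun a b => s a * s b * (if a == b then al else be))) /=.
  rewrite -[al - be]mul1r -s2 mulr_suml expr2 mulr_suml mulr_sumr -big_split /=.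
  apply: eq_bigr => a _; rewrite !mulr_sumr (bigD1 a) //= [in RHS](bigD1 a) //= eqxx.
  rewrite addrA; congr (_ + _); first by rewrite expr2 [be * _]mulrC -mulrDr subrK.
  by apply: eq_bigr => b /negPf ne_ba; rewrite eq_sym ne_ba mulrC.
(* What remains is (sum_a s_a)^2 <= k. *)
rewrite -addrA lerD2l addrC mulrBr mulr1 lerD2r ler_wpM2l ?sqrtC_ge0 ?mulr_ge0 ?ler0n //.
apply: le_trans (card_support_cauchy_schwarz s_ge0) _.
by rewrite s2 mulr1 card_s ler_nat.
Qed.

(** * Mixtures, and the passage to real square roots *)

Lemma trace_norm_bloch_le d1 d2
    (lam : 'I_(d1 ^ 2) -> 'M[C]_d1) (mu : 'I_(d2 ^ 2) -> 'M[C]_d2)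
    (rho : 'M[C]_(d1 * d2)) (B : 'M[C]_(d1 ^ 2, d2 ^ 2)) (r k : nat) (x y : C) :
  (0 < d1)%N -> (0 < d2)%N ->
  local_operator_basis lam -> local_operator_basis mu ->
  bloch_coefficient_matrix lam mu rho B ->
  mixture_of_rank_le rho r -> (r <= k)%N -> 0 <= x -> 0 <= y ->
  trace_norm (diag_head (d1 ^ 2) x *m B *m diag_head (d2 ^ 2) y)
    <= sqrtC ((d1%:R - 1 + x ^+ 2) * (d2%:R - 1 + y ^+ 2))
       + sqrtC (d1%:R * d2%:R) * (k%:R - 1).
Proof.
move=> d1_gt0 d2_gt0 lamB muB DB [n [p [psi [p_ge0 p1 psi1 rk_psi Drho]]]] le_rk.
move=> x_ge0 y_ge0; rewrite (bloch_coefficient_matrixE d1_gt0 d2_gt0 lamB muB DB).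
have [W Wc ->] := trace_norm_dual (diag_head _ x *m bloch_mx lam mu rho *m diag_head _ y).
rewrite Drho bloch_mx_sum mulmx_sumr mulmx_suml mulmx_sumr raddf_sum /=.
set bound := (X in _ <= X).
apply: le_trans (ler_norm_sum _ _ _) _.
(* The bound does not depend on the pure state, so it is its own average under [p]. *)
rewrite -[bound]mul1r -p1 mulr_suml ler_sum // => i _.
rewrite -scalemxAr -scalemxAl -scalemxAr mxtraceZ normrM ger0_norm // ler_wpM2l //.
have [q rk_q le_qr] := rk_psi i.
exact: schmidt_rank_bloch_le (psi1 i) rk_q (leq_trans le_qr le_rk) _ _ Wc.
Qed.

End TraceNorm.

(** Turns the [sqrtC] of the general bound into the real square roots of the theorem. *)
Lemma sqrtC_real_complex (R : realType) (z : R) :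
  0 <= z -> sqrtC z%:C = (Num.sqrt z)%:C.
Proof.
by move=> z_ge0; rewrite -{1}[z]sqr_sqrtr // rmorphXn /= sqrCK // ler0c sqrtr_ge0.
Qed.

Theorem corollary6 (R : realType) (d1 d2 : nat)
    (hd1 : (0 < d1)%N) (hd12 : (d1 <= d2)%N)
    (lam : 'I_(d1 ^ 2) -> 'M[R[i]]_d1) (mu : 'I_(d2 ^ 2) -> 'M[R[i]]_d2)
    (hlam : local_operator_basis lam) (hmu : local_operator_basis mu)
    (rho : 'M[R[i]]_(d1 * d2)) (hrho : density_matrix rho)
    (B : 'M[R[i]]_(d1 ^ 2, d2 ^ 2)) (hB : bloch_coefficient_matrix lam mu rho B)
    (k SN : nat) (hk : (1 <= k)%N)
    (hSN : schmidt_number rho SN) (hSNk : (SN <= k)%N)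
    (x y : R) (hx : 0 <= x) (hy : 0 <= y) :
  trace_norm (diag_head (d1 ^ 2) x%:C *m B *m diag_head (d2 ^ 2) y%:C)
    <= (Num.sqrt ((d1%:R - 1 + x ^+ 2) * (d2%:R - 1 + y ^+ 2))
        + Num.sqrt (d1%:R * d2%:R) * (k%:R - 1))%:C.
Proof.
have d2_gt0 := leq_trans hd1 hd12.
have ge0 (d : nat) (z : R) : (0 < d)%N -> 0 <= d%:R - 1 + z ^+ 2.
  by move=> d_gt0; rewrite addr_ge0 ?sqr_ge0 // subr_ge0 ler1n.
rewrite rmorphD rmorphM /= -!sqrtC_real_complex ?mulr_ge0 ?ge0 ?ler0n //.
rewrite !rmorphM /= !rmorphD /= !rmorphN1 !rmorphXn !rmorph_nat /=.
have [rho_mix _] := hSN.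
by apply: (trace_norm_bloch_le hd1 d2_gt0 hlam hmu hB rho_mix hSNk); rewrite ler0c.
Qed.
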